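(* Let $D_1$ be a first-derivative SBP operator on a grid with $N$ nodes with diagonal mass matrix $M$. Let $g>0$, let $\boldsymbol D=(D(x_1),\dots,D(x_N))^T\in\mathbb R^N$ be the vector of still water depths at the grid nodes, $K=\operatorname{diag}(\boldsymbol D^2)$ and $P_D=\operatorname{diag}(0,1,\dots,1,0)$. Consider the semidiscretization for $\boldsymbol\eta(t),\boldsymbol v(t)\in\mathbb R^N$ $$\boldsymbol\eta_t=-\Big(I-\tfrac16D_{2,N}^K\Big)^{-1}D_1(\boldsymbol D\boldsymbol v+\boldsymbol\eta\boldsymbol v),\qquad \boldsymbol v_t=-\Big(I-\tfrac16D_{2,D}K\Big)^{-1}D_1\Big(g\boldsymbol\eta+\tfrac12\boldsymbol v^2\Big),$$ with $v_1=v_N=0$ initially, where the inverse operators with Neumann and Dirichlet boundary conditions are as defined in the context. Then the semidiscretization conserves the total mass $\mathcal M(t)=\boldsymbol 1^TM\boldsymbol\eta$. If $P_DD_{2,D}=P_DD_1^2$, then it also conserves the total energy $\mathcal E(t)=\boldsymbol 1^TM\big(\tfrac12 g\boldsymbol\eta^2+\tfrac12(\boldsymbol\eta+\boldsymbol D)\boldsymbol v^2\big)$. In addition, the scheme is well-balanced: every lake-at-rest state $\boldsymbol v=\boldsymbol 0$, $\boldsymbol\eta=c\,\boldsymbol 1$ with $c\in\mathbb R$ is a stationary solution.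
   Context: Products and powers of vectors in $\mathbb R^N$ are taken componentwise: $(\boldsymbol u\boldsymbol v)_j=u_jv_j$, $(\boldsymbol u^k)_j=u_j^k$. $\boldsymbol 1=(1,\dots,1)^T$, $\boldsymbol 0=(0,\dots,0)^T$, $\boldsymbol e_L=(1,0,\dots,0)^T$, $\boldsymbol e_R=(0,\dots,0,1)^T$, $I$ is the identity matrix. ''Conserved'' means that the time derivative vanishes along every solution. A derivative matrix $A\in\mathbb R^{N\times N}$ is consistent if $A\boldsymbol 1=\boldsymbol 0$. A first-derivative SBP (summation-by-parts) operator consists of a grid $\boldsymbol x$, a consistent first-derivative matrix $D_1$ and a symmetric positive-definite matrix $M$ such that $MD_1+D_1^TM=\boldsymbol e_R\boldsymbol e_R^T-\boldsymbol e_L\boldsymbol e_L^T$. Throughout, $M$ is diagonal. Boundary-condition operators, for $\delta\in\mathbb R$ (used with $\delta=\frac16$): - Homogeneous Dirichlet: $D_{2,D}\in\mathbb R^{N\times N}$ is a second-derivative matrix, and the notation $\boldsymbol u=(I-\delta D_{2,D}K)^{-1}\boldsymbol w$ means, by definition, that $\boldsymbol u$ is the (assumed unique) vector satisfying $P_D(I-\delta D_{2,D}K)\boldsymbol u=P_D\boldsymbol w$ and $(I-P_D)\boldsymbol u=\boldsymbol 0$; in particular $u_1=u_N=0$. - Homogeneous Neumann (weak-strong imposition): $\boldsymbol u=(I-\delta D_{2,N}^K)^{-1}\boldsymbol w$ means $(I+\delta M^{-1}D_1^TMP_DKD_1)\boldsymbol u=\boldsymbol w$; equivalently $D_{2,N}^K=D_1P_DKD_1$.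 The system is a semidiscretization of the BBM-BBM equations with variable bathymetry $\eta_t+((\eta+D)v)_x-\frac16(D^2\eta_{xt})_x=0$, $v_t+g\eta_x+vv_x-\frac16(D^2v_t)_{xx}=0$ on $(x_{\min},x_{\max})$ with reflecting boundary conditions $\eta_x=0$, $v=0$ at both endpoints. *)

(* Defs.v *)
From mathcomp Require Export all_boot all_order all_algebra.
From mathcomp Require Export all_classical all_reals all_analysis.

Set Implicit Arguments.
Unset Strict Implicit.
Unset Printing Implicit Defensive.

Export Order.TTheory GRing.Theory Num.Theory.
Export numFieldNormedType.Exports.

Local Open Scope classical_set_scope.
Local Open Scope ring_scope.

Section Vectors.
Context {R : realType} {N : nat}.
Implicit Types u v : 'cV[R]_N.

Definition ones : 'cV[R]_N := const_mx 1.
Definition e_L : 'cV[R]_N := \col_i ((i : nat) == 0)%:R.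
Definition e_R : 'cV[R]_N := \col_i (i.+1 == N)%:R.
Definition P_D : 'M[R]_N :=
  diag_mx (\row_i (((i : nat) != 0) && (i.+1 != N))%:R).

Definition vmul u v : 'cV[R]_N := map2_mx *%R u v.
Definition vexp u (k : nat) : 'cV[R]_N := map_mx (fun a => a ^+ k) u.
Definition diag u : 'M[R]_N := diag_mx u^T.

(* 1^T M u *)
Definition quadrature (M : 'M[R]_N) u : R := (ones^T *m M *m u) 0 0.

End Vectors.

Notation "u \** v" := (vmul u v) (at level 40, left associativity) : ring_scope.
Notation "u \*^ k" := (vexp u k) (at level 29, left associativity) : ring_scope.

(* No ordering of the nodes is imposed. *)
Record sbp_operator (R : realType) (N : nat) := SbpOperator {
  sbp_grid : 'cV[R]_N;
  sbp_D1 : 'M[R]_N;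
  sbp_mass : 'M[R]_N;
  sbp_consistent : sbp_D1 *m ones = 0;
  sbp_mass_sym : sbp_mass^T = sbp_mass;
  sbp_mass_posdef :
    forall u : 'cV[R]_N, u != 0 -> 0 < (u^T *m sbp_mass *m u) 0 0;
  sbp_by_parts :
    sbp_mass *m sbp_D1 + sbp_D1^T *m sbp_mass = e_R *m e_R^T - e_L *m e_L^T
}.

Section BoundaryOperators.
Context {R : realType} {N : nat}.

(* u = (I - delta D2D K)^-1 w, homogeneous Dirichlet boundary conditions. *)
Definition dirichlet_inv (delta : R) (D2D K : 'M[R]_N) (w u : 'cV[R]_N) : Prop :=
  P_D *m ((1%:M - delta *: (D2D *m K)) *m u) = P_D *m w /\
  (1%:M - P_D) *m u = 0.

(* u = (I - delta D2N^K)^-1 w, homogeneous Neumann boundary conditions. *)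
Definition neumann_inv (delta : R) (S : sbp_operator R N) (K : 'M[R]_N)
    (w u : 'cV[R]_N) : Prop :=
  let D1 := sbp_D1 S in let M := sbp_mass S in
  (1%:M + delta *: (invmx M *m D1^T *m M *m P_D *m K *m D1)) *m u = w.

End BoundaryOperators.

Section Semidiscretization.
Context {R : realType} {N : nat}.
Variables (S : sbp_operator R N) (D2D : 'M[R]_N) (g : R) (depth : R -> R).

Local Notation D1 := (sbp_D1 S).
Local Notation M := (sbp_mass S).

Definition depth_vec : 'cV[R]_N := map_mx depth (sbp_grid S).
Definition depth_sq : 'M[R]_N := diag (depth_vec \*^ 2).

Local Notation D := depth_vec.
Local Notation K := depth_sq.

Definition eta_flux (eta v : 'cV[R]_N) : 'cV[R]_N := D \** v + eta \** v.
Definition v_flux (eta v : 'cV[R]_N) : 'cV[R]_N := g *: eta + 2^-1 *: v \*^ 2.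

(* eta and v solve the semidiscretization on [t0, T[ : they are continuous up to
   the initial time t0, and the differential equations hold on ]t0, T[.
   The two inverses are linear relations, so that eta_t = - u with u the image
   of w is written as "- eta_t is the image of w". *)
Record bbm_ode (t0 T : R) (eta v : R -> 'cV[R]_N) : Prop := BbmOde {
  bbm_eta_continuous : {within `[t0, T[, continuous eta};
  bbm_v_continuous : {within `[t0, T[, continuous v};
  bbm_eta_derivable : forall t, t \in `]t0, T[ -> derivable eta t 1;
  bbm_v_derivable : forall t, t \in `]t0, T[ -> derivable v t 1;
  bbm_eta_eq : forall t, t \in `]t0, T[ ->
    neumann_inv 6^-1 S K (D1 *m eta_flux (eta t) (v t)) (- 'D_1 eta t);
  bbm_v_eq : forall t, t \in `]t0, T[ ->
    dirichlet_inv 6^-1 D2D K (D1 *m v_flux (eta t) (v t)) (- 'D_1 v t)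
}.

Definition bbm_solution (t0 T : R) (eta v : R -> 'cV[R]_N) : Prop :=
  [/\ bbm_ode t0 T eta v, e_L^T *m v t0 = 0 & e_R^T *m v t0 = 0].

Definition total_mass (eta : 'cV[R]_N) : R := quadrature M eta.

Definition total_energy (eta v : 'cV[R]_N) : R :=
  quadrature M ((2^-1 * g) *: eta \*^ 2 + 2^-1 *: ((eta + D) \** v \*^ 2)).

(* The derivative vanishes at interior times; the second clause accounts for the
   initial time t0, where only one-sided information is available. *)
Definition conserved (Q : 'cV[R]_N -> 'cV[R]_N -> R) : Prop :=
  forall (t0 T : R) (eta v : R -> 'cV[R]_N), bbm_solution t0 T eta v ->
    (forall t, t \in `]t0, T[ ->
       is_derive t (1 : R) (fun s => Q (eta s) (v s)) 0) /\
    (forall t, t \in `[t0, T[ -> Q (eta t) (v t) = Q (eta t0) (v t0)).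

Definition stationary (eta0 v0 : 'cV[R]_N) : Prop :=
  forall t0 T : R, bbm_solution t0 T (fun=> eta0) (fun=> v0).

End Semidiscretization.

(* Main.v *)
(** Write [<a, b> = a^T M b], [f = (D + eta) v], [h = g eta + v^2 / 2],
    [u = - eta_t], [z = - v_t].  Summation by parts makes [D1] skew for this
    product as soon as one argument vanishes at both endpoints, which holds for
    [v], hence for [f], for [z], and for [K z].

    Mass: [<1, u> = <1, D1 f> = - <D1 1, f> = 0].

    Energy: the energy rate is [- (<h, u> + <f, z>)].  Insert the two equations
    in [<h, D1 f> + <f, D1 h> = 0].  The first-order terms in [delta] cancel
    because [D1] is skew between [K z] and [u], and the second-order terms
    cancel because [P_D], [K] and [M] are commuting diagonal matrices: both
    equal [<D1 D1 K z, P_D K D1 u>]. *)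
Require Import Defs.
From mathcomp Require Import ring.
Set Implicit Arguments.
Unset Strict Implicit.
Unset Printing Implicit Defensive.
Local Open Scope classical_set_scope.
Local Open Scope ring_scope.

(** * Bilinear algebra of the Euclidean dot product *)

Section DotProduct.
Context {R : comNzRingType} {N : nat}.
Implicit Types (a b c : 'cV[R]_N) (A : 'M[R]_N).

Definition dot a b : R := (a^T *m b) 0 0.

Lemma dotE a b : dot a b = \sum_i a i 0 * b i 0.
Proof. by rewrite /dot mxE; apply: eq_bigr => i _; rewrite mxE. Qed.

Lemma dotC a b : dot a b = dot b a.
Proof. by rewrite !dotE; apply: eq_bigr => i _; rewrite mulrC. Qed.

Lemma dotDr a b c : dot a (b + c) = dot a b + dot a c.
Proof. by rewrite /dot mulmxDr mxE. Qed.

Lemma dotZr k a b : dot a (k *: b) = k * dot a b.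
Proof. by rewrite /dot -scalemxAr mxE. Qed.

Lemma dotNr a b : dot a (- b) = - dot a b.
Proof. by rewrite -scaleN1r dotZr mulN1r. Qed.

Lemma dotDl a b c : dot (a + b) c = dot a c + dot b c.
Proof. by rewrite dotC dotDr !(dotC c). Qed.

Lemma dotZl k a b : dot (k *: a) b = k * dot a b.
Proof. by rewrite dotC dotZr dotC. Qed.

Lemma dot_trmx A a b : dot a (A *m b) = dot (A^T *m a) b.
Proof. by rewrite /dot trmx_mul trmxK mulmxA. Qed.

Lemma dot0 a : dot a 0 = 0.
Proof. by rewrite /dot mulmx0 mxE. Qed.
End DotProduct.

(** The purely algebraic core of energy conservation, free of time. The Neumann equation enters
    multiplied by [M], which avoids [invmx M]. The hypothesis on [M *m D1 + D1^T *m M] says that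
    boundary terms vanish on vectors fixed by [P]. *)
Lemma dirichlet_neumann_balance (R : comNzRingType) (N : nat) (delta : R)
    (D1 M P K : 'M[R]_N) (f h u z : 'cV[R]_N) :
  M^T = M -> K^T = K -> P^T = P ->
  M *m P = P *m M -> M *m K = K *m M -> P *m K = K *m P ->
  (M *m D1 + D1^T *m M) *m P = 0 ->
  P *m f = f -> P *m z = z ->
  M *m u + delta *: (D1^T *m (M *m (P *m (K *m (D1 *m u))))) = M *m (D1 *m f) ->
  z = P *m (D1 *m h) + delta *: (P *m (D1 *m (D1 *m (K *m z)))) ->
  dot h (M *m u) + dot f (M *m z) = 0.
Proof.
move=> Msym Ksym Psym MP MK PK BP Pf Pz hu hz.
(* Only [b] has to vanish at the endpoints; [a] is arbitrary. *)
have sbp a b : P *m b = b -> dot a (M *m (D1 *m b)) = - dot b (M *m (D1 *m a)).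
  move=> Pb; apply/eqP; rewrite -addr_eq0; apply/eqP.
  rewrite [X in _ + X]dot_trmx Msym [X in _ + X]dot_trmx [X in _ + X]dotC.
  by rewrite -dotDr !mulmxA -mulmxDl -Pb mulmxA BP mul0mx dot0.
set q := K *m z; set X := dot (D1 *m (D1 *m q)) (M *m (P *m (K *m (D1 *m u)))).
have Pq : P *m q = q by rewrite /q mulmxA PK -mulmxA Pz.
have zr : dot z (M *m (K *m (D1 *m u))) = dot q (M *m (D1 *m u)).
  by rewrite mulmxA MK -mulmxA dot_trmx Ksym.
have fP c : dot f (M *m (P *m c)) = dot f (M *m c).
  by rewrite mulmxA MP -mulmxA dot_trmx Psym Pf.
(* The Neumann equation replaces [D1 *m f]. Its [delta] term pairs [P *m (D1 *m h)] with
   [K *m (D1 *m u)], and the Dirichlet equation evaluates this. *)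
have e1 : dot h (M *m (D1 *m f)) =
    dot h (M *m u) + delta * (dot q (M *m (D1 *m u)) - delta * X).
  rewrite -hu dotDr dotZr; congr (_ + _ * _).
  rewrite -zr [in X in _ = X - _]hz dotDl dotZl /X.
  rewrite (dot_trmx D1^T) trmxK.
  have PM a b : dot a (M *m (P *m b)) = dot (P *m a) (M *m b).
    by rewrite mulmxA MP -mulmxA dot_trmx Psym.
  by rewrite !PM addrK.
(* Since [P] fixes [f], it may be inserted before [D1 *m h], so the Dirichlet equation applies.
   Skewness then moves one [D1] onto [f], where the Neumann equation applies again. *)
have e2 : dot f (M *m (D1 *m h)) =
    dot f (M *m z) - delta * (dot q (M *m (D1 *m u)) - delta * X).
  rewrite -fP; have -> : P *m (D1 *m h) = z - delta *: (P *m (D1 *m (D1 *m q))).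
    by apply/eqP; rewrite -subr_eq opprK -hz.
  rewrite mulmxBr -scalemxAr dotDr dotNr dotZr fP.
  have -> : dot f (M *m (D1 *m (D1 *m q))) = - dot (D1 *m q) (M *m (D1 *m f)).
    by rewrite (sbp _ f)// opprK.
  have uq : dot (D1 *m q) (M *m u) = - dot q (M *m (D1 *m u)).
    by rewrite dot_trmx Msym dotC (sbp _ q).
  rewrite -hu dotDr dotZr uq (dot_trmx D1^T) trmxK -/X; ring.
have : dot h (M *m (D1 *m f)) + dot f (M *m (D1 *m h)) = 0.
  by rewrite (sbp h f)// addrC subrr.
by rewrite e1 e2 => <-; ring.
Qed.

(** * Calculus of functions of time, up to the initial time *)

Section Calculus.
Context {R : realType}.

(** Mean value theorem on the segment from [a] to [t]: continuity at [a] makes up for the missing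
    derivative there. *)
Lemma within_derive0_cst (f : R -> R) (a b : R) :
  {within `[a, b[, continuous f} ->
  (forall t, t \in `]a, b[ -> is_derive t (1 : R) f 0) ->
  forall t, t \in `[a, b[ -> f t = f a.
Proof.
move=> cf df t; rewrite in_itv/= => /andP[at_ tb].
have [] := @MVT_segment R f (fun=> 0) a t at_.
- move=> x; rewrite in_itv/= => /andP[ax xt]; apply: df.
  by rewrite in_itv/= ax (lt_trans xt).
- apply: continuous_subspaceW cf => x /=; rewrite !in_itv/= => /andP[-> xt].
  exact: le_lt_trans tb.
- by move=> c _ /eqP; rewrite mul0r subr_eq0 => /eqP.
Qed.

Lemma within_continuous_coord (m n : nat) (A : set R) (f : R -> 'M[R]_(m, n)) i j :
  {within A, continuous f} -> {within A, continuous (fun t => f t i j)}.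
Proof.
move=> cf x.
apply: (@continuous_comp (subspace A) _ _ f (fun B : 'M[R]_(m, n) => B i j)).
  exact: cf.
exact: coord_continuous.
Qed.

Lemma is_derive_coord (m n : nat) (f : R -> 'M[R]_(m, n)) (t : R) i j :
  derivable f t 1 -> is_derive t (1 : R) (fun s => f s i j) ('D_1 f t i j).
Proof.
move=> df; have /derivable_mxP/(_ i j)/derivableP := df.
by rewrite derive_mx// mxE.
Qed.

Lemma within_continuous_sum (A : set R) n (f : 'I_n -> R -> R) :
  (forall i, {within A, continuous (f i)}) ->
  {within A, continuous (fun t => \sum_i f i t)}.
Proof.
move=> cf; rewrite -[X in {within _, continuous X}]fct_sumE.
elim/big_ind: _ => // [x|g h cg ch x].
  exact: (@cst_continuous (subspace A)).
by apply: continuousD; [exact: cg|exact: ch].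
Qed.
End Calculus.

(** * The SBP operator and the boundary projection *)

Section SBP.
Context {R : realType} {N : nat}.
Variable S : sbp_operator R N.
Local Notation D1 := (sbp_D1 S).
Local Notation M := (sbp_mass S).

(** A nonzero kernel vector would annihilate the positive-definite form. *)
Lemma sbp_mass_unit : M \in unitmx.
Proof.
rewrite -row_free_unit; apply: contraT.
rewrite -kermx_eq0 => /rowV0Pn[u /sub_kermxP uM u0].
have : u^T != 0 by rewrite trmx_eq0.
by move/(sbp_mass_posdef S); rewrite trmxK uM mul0mx mxE ltxx.
Qed.

Lemma quadratureE (w : 'cV[R]_N) : is_diag_mx M ->
  quadrature M w = \sum_i M i i * w i 0.
Proof.
move=> /is_diag_mxP Md; rewrite /quadrature -mulmxA mxE; apply: eq_bigr => i _.
rewrite !mxE mul1r (bigD1 i)//= big1 ?addr0// => j ji.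
by rewrite Md ?mul0r// eq_sym.
Qed.

Lemma P_DE (u : 'cV[R]_N) i :
  (P_D *m u) i 0 = if ((i : nat) != 0) && (i.+1 != N) then u i 0 else 0.
Proof.
rewrite /P_D mul_diag_mx !mxE; by case: ifP; rewrite ?mul1r ?mul0r.
Qed.

Lemma P_D_fixed (u : 'cV[R]_N) :
  P_D *m u = u <-> forall i : 'I_N, (i : nat) = 0 \/ i.+1 = N -> u i 0 = 0.
Proof.
split=> [<- i|u0].
  by rewrite P_DE => -[|] ->; rewrite eqxx ?andbF.
apply/colP => i; rewrite P_DE; case: ifPn => //.
by rewrite negb_and !negbK => /orP[]/eqP H; rewrite u0//; [left|right].
Qed.

Lemma e_L_P_D : e_L^T *m P_D = 0 :> 'rV[R]_N.
Proof.
apply/rowP => i; rewrite /P_D mul_mx_diag !mxE.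
by case: eqP => //=; rewrite ?mul0r ?mulr0.
Qed.

Lemma e_R_P_D : e_R^T *m P_D = 0 :> 'rV[R]_N.
Proof.
apply/rowP => i; rewrite /P_D mul_mx_diag !mxE.
by case: eqP => //=; rewrite ?andbF ?mul0r ?mulr0.
Qed.

(** The boundary matrix reads only the first and last entries, which [P_D] erases. *)
Lemma sbp_P_D : (M *m D1 + D1^T *m M) *m P_D = 0.
Proof. by rewrite sbp_by_parts mulmxBl -!mulmxA e_L_P_D e_R_P_D !mulmx0 subrr. Qed.

End SBP.

(** * Conservation laws and lake-at-rest states *)

Section Semidiscretization.
Context {R : realType} {N : nat}.
Variables (S : sbp_operator R N) (D2D : 'M[R]_N) (g : R) (depth : R -> R).
Hypothesis Mdiag : is_diag_mx (sbp_mass S).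
Local Notation D1 := (sbp_D1 S).
Local Notation M := (sbp_mass S).
Local Notation D := (depth_vec S depth).
Local Notation K := (depth_sq S depth).

Lemma boundary_coord (v : 'cV[R]_N) (i : 'I_N) :
  e_L^T *m v = 0 -> e_R^T *m v = 0 -> (i : nat) = 0 \/ i.+1 = N -> v i 0 = 0.
Proof.
move=> /matrixP/(_ 0 0) + /matrixP/(_ 0 0); rewrite !mxE => vL vR [i0|iN].
- rewrite -[RHS]vL (bigD1 i)//= big1 => [|j ji].
    by rewrite !mxE i0 eqxx mul1r addr0.
  rewrite !mxE; case: eqP; rewrite ?mul0r// => j0; case/eqP: ji.
  by apply: val_inj; rewrite /= j0.
- rewrite -[RHS]vR (bigD1 i)//= big1 => [|j ji].
    by rewrite !mxE iN eqxx mul1r addr0.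
  rewrite !mxE; case: eqP; rewrite ?mul0r// => jN; case/eqP: ji.
  by apply: val_inj; apply: succn_inj; rewrite jN iN.
Qed.

Lemma bbm_derive_P_D t0 T eta v t : bbm_ode S D2D g depth t0 T eta v ->
  t \in `]t0, T[ -> P_D *m 'D_1 v t = 'D_1 v t.
Proof.
move=> sol tT; have [_ /eqP] := bbm_v_eq sol tT.
by rewrite mulmxN oppr_eq0 mulmxBl mul1mx subr_eq0 => /eqP <-.
Qed.

(** The boundary values are prescribed at [t0] only. They persist because the Dirichlet relation
    makes the boundary entries of the time derivative of [v] vanish. *)
Lemma bbm_solution_P_D t0 T eta v t : bbm_solution S D2D g depth t0 T eta v ->
  t \in `[t0, T[ -> P_D *m v t = v t.
Proof.
move=> [sol vL vR] tT; apply/P_D_fixed => i iB.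
rewrite -(boundary_coord vL vR iB).
apply: (within_derive0_cst (f := fun s => v s i 0) (a := t0) (b := T)) => //.
  exact: within_continuous_coord (bbm_v_continuous sol).
move=> s sT; apply: is_derive_eq; first exact: is_derive_coord (bbm_v_derivable sol sT).
by have /P_D_fixed := bbm_derive_P_D sol sT; apply.
Qed.

Lemma eta_flux_P_D t0 T eta v t : bbm_solution S D2D g depth t0 T eta v ->
  t \in `]t0, T[ -> P_D *m eta_flux S depth (eta t) (v t) = eta_flux S depth (eta t) (v t).
Proof.
move=> sol tT; apply/P_D_fixed => i iB.
have tT' : t \in `[t0, T[ by move: tT; rewrite !in_itv/= => /andP[/ltW -> ->].
have /P_D_fixed/(_ i iB) := bbm_solution_P_D sol tT'.
by rewrite !mxE => ->; rewrite !mulr0 addr0.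
Qed.

Lemma bbm_eta_implicit t0 T eta v t : bbm_ode S D2D g depth t0 T eta v ->
  t \in `]t0, T[ ->
  M *m 'D_1 eta t + 6^-1 *: (D1^T *m (M *m (P_D *m (K *m (D1 *m 'D_1 eta t))))) =
  - (M *m (D1 *m eta_flux S depth (eta t) (v t))).
Proof.
move=> sol tT; rewrite -(bbm_eta_eq sol tT) mulmxN mulmxN opprK mulmxDl mul1mx.
by rewrite mulmxDr -!scalemxAl -scalemxAr !mulmxA mulmxV ?sbp_mass_unit// mul1mx.
Qed.

Lemma bbm_v_implicit t0 T eta v t : bbm_ode S D2D g depth t0 T eta v ->
  P_D *m D2D = P_D *m (D1 *m D1) -> t \in `]t0, T[ ->
  - 'D_1 v t = P_D *m (D1 *m v_flux g (eta t) (v t)) +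
     6^-1 *: (P_D *m (D1 *m (D1 *m (K *m (- 'D_1 v t))))).
Proof.
move=> sol P2 tT; have [<- _] := bbm_v_eq sol tT.
rewrite mulmxBl mul1mx mulmxBr -!scalemxAl -!scalemxAr !mulmxA P2 -!mulmxA.
by rewrite subrK mulmxN (bbm_derive_P_D sol tT).
Qed.

Lemma dot_massE (a b : 'cV[R]_N) : dot a (M *m b) = \sum_i M i i * (a i 0 * b i 0).
Proof.
have /is_diag_mxP Md := Mdiag.
rewrite dotE; apply: eq_bigr => i _; rewrite mxE (bigD1 i)//= big1 ?addr0.
  by rewrite mulrCA.
by move=> j ji; rewrite Md ?mul0r// eq_sym.
Qed.

Lemma mass_rate t0 T eta v t : bbm_solution S D2D g depth t0 T eta v ->
  t \in `]t0, T[ -> dot ones (M *m 'D_1 eta t) = 0.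
Proof.
move=> sol tT; have Pf := eta_flux_P_D sol tT.
have [sol' _ _] := sol.
have := congr1 (dot ones) (bbm_eta_implicit sol' tT).
(* Moving [D1^T] onto [ones] produces [D1 *m ones = 0], so the Neumann term drops out. *)
rewrite dotDr dotZr (dot_trmx D1^T) trmxK sbp_consistent [dot 0 _]dotC dot0 mulr0 addr0.
move=> ->; rewrite dotNr; apply/eqP; rewrite oppr_eq0; apply/eqP.
set f := eta_flux _ _ _ _ in Pf *.
have /eqP := congr1 (fun A => dot ones (A *m f)) (sbp_P_D S).
rewrite -mulmxA Pf mul0mx dot0 mulmxDl dotDr -!mulmxA (dot_trmx D1^T) trmxK sbp_consistent.
by rewrite [dot 0 _]dotC dot0 addr0 => /eqP.
Qed.

Lemma diag_mulC (a b : 'rV[R]_N) : diag_mx a *m diag_mx b = diag_mx b *m diag_mx a.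
Proof.
by rewrite !mulmx_diag; congr diag_mx; apply/rowP => i; rewrite !mxE mulrC.
Qed.

(** The two fluxes are the partial gradients of the energy density in [eta] and [v], so the
    left-hand side is the rate of change of the energy. *)
Lemma energy_rate t0 T eta v t : bbm_solution S D2D g depth t0 T eta v ->
  P_D *m D2D = P_D *m (D1 *m D1) -> t \in `]t0, T[ ->
  dot (v_flux g (eta t) (v t)) (M *m 'D_1 eta t) +
  dot (eta_flux S depth (eta t) (v t)) (M *m 'D_1 v t) = 0.
Proof.
move=> sol P2 tT; have Pf := eta_flux_P_D sol tT.
have [sol' _ _] := sol; have /diag_mxP[d Md] := Mdiag.
have := @dirichlet_neumann_balance _ _ 6^-1 D1 M P_D K
  (eta_flux S depth (eta t) (v t)) (v_flux g (eta t) (v t)) (- 'D_1 eta t) (- 'D_1 v t).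
rewrite !mulmxN !dotNr -opprD => H; apply/eqP; rewrite -oppr_eq0; apply/eqP; apply: H => //.
- exact: sbp_mass_sym.
- exact: tr_diag_mx.
- exact: tr_diag_mx.
- by rewrite Md diag_mulC.
- by rewrite Md diag_mulC.
- exact: diag_mulC.
- exact: sbp_P_D.
- by rewrite (bbm_derive_P_D sol' tT).
- by rewrite scalerN -opprD (bbm_eta_implicit sol' tT) opprK.
- by rewrite {1}(bbm_v_implicit sol' P2 tT) !mulmxN.
Qed.

(** Shared reduction for mass and energy: [q] is a nodal density and [dq] its chain-rule derivative.
    Continuity of [q] carries constancy back to [t0]. *)
Lemma conserved_sum (Q : 'cV[R]_N -> 'cV[R]_N -> R)
    (q : 'I_N -> R -> R -> R) (dq : 'I_N -> R -> R -> R -> R -> R) :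
  (forall eta v, Q eta v = \sum_i M i i * q i (eta i 0) (v i 0)) ->
  (forall i e v (A : set R), {within A, continuous e} -> {within A, continuous v} ->
     {within A, continuous (fun t : R => q i (e t) (v t))}) ->
  (forall i e v (t : R) de dv, is_derive t (1 : R) e de -> is_derive t (1 : R) v dv ->
    is_derive t (1 : R) (fun t => q i (e t) (v t)) (dq i (e t) (v t) de dv)) ->
  (forall t0 T eta v t, bbm_solution S D2D g depth t0 T eta v -> t \in `]t0, T[ ->
    \sum_i M i i * dq i (eta t i 0) (v t i 0) ('D_1 eta t i 0) ('D_1 v t i 0) = 0) ->
  conserved S D2D g depth Q.
Proof.
move=> QE cq dqP rate t0 T eta v sol; have [sol' _ _] := sol.
pose E t := \sum_i M i i * q i (eta t i 0) (v t i 0).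
have -> : (fun s => Q (eta s) (v s)) = E by apply/funext => s; exact: QE.
have dE t : t \in `]t0, T[ -> is_derive t (1 : R) E 0.
  move=> tT; rewrite -(rate _ _ _ _ _ sol tT) /E.
  rewrite -[X in is_derive _ _ X _]fct_sumE.
  apply: is_derive_sum => i; apply: is_deriveZ; apply: dqP.
    exact: is_derive_coord (bbm_eta_derivable sol' tT).
  exact: is_derive_coord (bbm_v_derivable sol' tT).
split=> // t tT; rewrite !QE; apply: (@within_derive0_cst _ E t0 T) => //.
apply: within_continuous_sum => i x; apply: continuousM.
  exact: (@cst_continuous (subspace _)).
apply: cq; apply: within_continuous_coord.
  exact: bbm_eta_continuous sol'.
exact: bbm_v_continuous sol'.
Qed.

Lemma mass_conserved : conserved S D2D g depth (fun eta _ => total_mass S eta).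
Proof.
apply: (conserved_sum
  (q := fun _ e _ => e) (dq := fun _ _ _ de _ => de)) => //.
- by move=> eta _; exact: quadratureE.
- move=> t0 T eta v t sol tT; rewrite -[RHS](mass_rate sol tT) dot_massE.
  by apply: eq_bigr => i _; rewrite [ones _ _]mxE mul1r.
Qed.

Lemma energy_conserved : P_D *m D2D = P_D *m (D1 *m D1) ->
  conserved S D2D g depth (total_energy S g depth).
Proof.
move=> P2; apply: (conserved_sum
  (* The coefficients of [de] and [dv] in [dq] are the nodal entries of [v_flux] and [eta_flux],
     matching [energy_rate]. *)
  (q := fun i e v => 2^-1 * g * e ^+ 2 + 2^-1 * ((e + D i 0) * v ^+ 2))
  (dq := fun i e v de dv => (g * e + 2^-1 * v ^+ 2) * de + (D i 0 * v + e * v) * dv)).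
- move=> eta v; rewrite /total_energy quadratureE//; apply: eq_bigr => i _.
  by rewrite !mxE.
- move=> i e v A ce cv x.
  have cX (f : R -> R) : {within A, continuous f} ->
      {for x, continuous ((fun t => f t ^+ 2) : subspace A -> R)}.
    by move=> cf; apply: (cvgM (cf x) (cf x)).
  have cC (k : R) : {for x, continuous ((fun=> k) : subspace A -> R)}.
    exact: (@cst_continuous (subspace A)).
  rewrite /continuous_at.
  apply: cvgD; apply: cvgM; [exact: cC|exact: cX|exact: cC|].
  by apply: cvgM; [apply: cvgD; [exact: ce|exact: cC]|exact: cX].
- move=> i e v t de dv he hv.
  (* The density is rewritten with operations on functions, so that the derivative rules compose. *)
  have hE : is_derive t (1 : R) ((2^-1 * g) \*: (e ^+ 2) + 2^-1 \*: ((e + cst (D i 0)) * v ^+ 2))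
     ((g * e t + 2^-1 * v t ^+ 2) * de + (D i 0 * v t + e t * v t) * dv).
    apply: is_derive_eq => /=.
    rewrite -[(v ^+ 2) t]/(v t * v t) -[(e + cst (D i 0)) t]/(e t + D i 0).
    by rewrite addr0 /GRing.scale/=; field.
  exact: hE.
- move=> t0 T eta v t sol tT; rewrite -[RHS](energy_rate sol P2 tT) !dot_massE.
  by rewrite -big_split/=; apply: eq_bigr => i _; rewrite -mulrDr !mxE.
Qed.

(** At rest [eta_flux] is zero and [v_flux] is a multiple of [ones], which [D1] annihilates; zero
    time derivatives then satisfy both inverse relations. *)
Lemma lake_at_rest c : stationary S D2D g depth (c *: ones) 0.
Proof.
move=> t0 T.
have D0 (w : 'cV[R]_N) (t : R) : 'D_1 (fun=> w) t = 0 by exact: derive_cst.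
split; rewrite ?mulmx0//; split.
- by move=> x; exact: (@cst_continuous (subspace _)).
- by move=> x; exact: (@cst_continuous (subspace _)).
- by move=> *; exact: derivable_cst.
- by move=> *; exact: derivable_cst.
- move=> t _; rewrite D0 oppr0 /neumann_inv mulmx0 /eta_flux.
  have -> : D \** 0 + (c *: ones) \** 0 = 0.
    by apply/colP => i; rewrite !mxE !mulr0 addr0.
  by rewrite mulmx0.
- move=> t _; rewrite D0 oppr0 /dirichlet_inv !mulmx0 /v_flux.
  have -> : 0 \*^ 2 = 0 :> 'cV[R]_N by apply/colP => i; rewrite !mxE expr0n.
  by rewrite scaler0 addr0 -!scalemxAr sbp_consistent mulmx0 !scaler0.
Qed.
End Semidiscretization.

Theorem theorem3p10 (R : realType) (N : nat) (S : sbp_operator R N)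
    (D2D : 'M[R]_N) (g : R) (depth : R -> R)
    (hM : is_diag_mx (sbp_mass S))
    (hg : 0 < g)
    (hD : forall w : 'cV[R]_N,
       exists! u : 'cV[R]_N, dirichlet_inv 6^-1 D2D (depth_sq S depth) w u) :
  [/\ conserved S D2D g depth (fun eta _ => total_mass S eta),
      P_D *m D2D = P_D *m (sbp_D1 S *m sbp_D1 S) ->
        conserved S D2D g depth (total_energy S g depth)
    & forall c : R, stationary S D2D g depth (c *: ones) 0].
Proof.
split; [exact: mass_conserved|exact: energy_conserved|exact: lake_at_rest].
Qed.
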